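(* Let $\theta_1<\theta_2$ be real numbers, let $\alpha\in(0,1]$, and let $f:[\theta_1,\theta_2]\to\mathbb{R}$ be differentiable on $(\theta_1,\theta_2)$ with $f\in H^1(\theta_1,\theta_2)$. Then $$\frac{2(\theta_2-\theta_1)^{\alpha}+(1-\alpha)2^{\alpha+1}\Gamma(\alpha)}{(\theta_2-\theta_1)^{\alpha+1}}\left[f(\theta_1)+f(\theta_2)+2f\left(\tfrac{\theta_1+\theta_2}{2}\right)\right]$$ $$-\frac{2^{\alpha+1}B(\alpha)\Gamma(\alpha)}{(\theta_2-\theta_1)^{\alpha+1}}\left[\left({}^{AB}I^{\alpha}_{\frac{\theta_1+\theta_2}{2}}f\right)(\theta_1)+\left({}^{AB}_{\theta_1}I^{\alpha}f\right)\left(\tfrac{\theta_1+\theta_2}{2}\right)+\left({}^{AB}_{\frac{\theta_1+\theta_2}{2}}I^{\alpha}f\right)(\theta_2)+\left({}^{AB}I^{\alpha}_{\theta_2}f\right)\left(\tfrac{\theta_1+\theta_2}{2}\right)\right]$$ $$=\int_0^1\left((1-t)^{\alpha}-t^{\alpha}\right)f'\left(\tfrac{1+t}{2}\theta_1+\tfrac{1-t}{2}\theta_2\right)dt+\int_0^1\left(t^{\alpha}-(1-t)^{\alpha}\right)f'\left(\tfrac{1+t}{2}\theta_2+\tfrac{1-t}{2}\theta_1\right)dt.$$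
   Context: $\Gamma$ is the Gamma function and $B(\alpha)>0$ is the value at $\alpha$ of a normalization function $B$. $f\in H^1(\theta_1,\theta_2)$ means that $f$ is absolutely continuous on $[\theta_1,\theta_2]$ with $f'$ square integrable. The left and right Atangana-Baleanu fractional integrals of order $\alpha$ are, for $a<b$ in $[\theta_1,\theta_2]$, $$\left({}^{AB}_{a}I^{\alpha}f\right)(t)=\frac{1-\alpha}{B(\alpha)}f(t)+\frac{\alpha}{B(\alpha)\Gamma(\alpha)}\int_a^t f(y)(t-y)^{\alpha-1}\,dy\quad(t>a),$$ $$\left({}^{AB}I^{\alpha}_{b}f\right)(t)=\frac{1-\alpha}{B(\alpha)}f(t)+\frac{\alpha}{B(\alpha)\Gamma(\alpha)}\int_t^b f(y)(y-t)^{\alpha-1}\,dy\quad(t<b).$$ *)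

(* Defs.v *)
From mathcomp Require Import all_boot all_order all_algebra.
From mathcomp Require Import all_classical all_reals all_analysis.

Set Implicit Arguments.
Unset Strict Implicit.
Unset Printing Implicit Defensive.

Import Order.TTheory GRing.Theory Num.Theory.
Import numFieldNormedType.Exports.

Local Open Scope classical_set_scope.
Local Open Scope ring_scope.

(* The open interval ]0, +oo[ avoids the convention 0 `^ s = 0 for s != 0. *)
Definition Gamma (R : realType) (s : R) : R :=
  \int[lebesgue_measure]_(x in `]0, +oo[%classic) (x `^ (s - 1) * expR (- x)).

Definition absolutely_continuous (R : realType) (a b : R) (f : R -> R) : Prop :=
  forall e : R, 0 < e -> exists2 d : R, 0 < d &
    forall (n : nat) (u v : 'I_n -> R),
      (forall i, a <= u i /\ u i <= v i /\ v i <= b) ->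
      trivIset [set: 'I_n] (fun i => `]u i, v i[%classic) ->
      \sum_(i < n) (v i - u i) < d ->
      \sum_(i < n) `|f (v i) - f (u i)| < e.

(* The derivative is cut off to ]a, b[ because Lfun is a space of functions on
   the whole line; only the values of f on [a, b] matter. *)
Definition H1 (R : realType) (a b : R) (f : R -> R) : Prop :=
  absolutely_continuous a b f /\
  (derive1 f \_ `]a, b[%classic : R -> R) \in Lfun (@lebesgue_measure R) 2%:E.

Definition ABIl (R : realType) (B : R -> R) (alpha a : R) (f : R -> R) (t : R)
    : R :=
  (1 - alpha) / B alpha * f t +
  alpha / (B alpha * Gamma alpha) *
    \int[lebesgue_measure]_(y in `[a, t]%classic)
       (f y * (t - y) `^ (alpha - 1)).

Definition ABIr (R : realType) (B : R -> R) (alpha b : R) (f : R -> R) (t : R)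
    : R :=
  (1 - alpha) / B alpha * f t +
  alpha / (B alpha * Gamma alpha) *
    \int[lebesgue_measure]_(y in `[t, b]%classic)
       (f y * (y - t) `^ (alpha - 1)).

(* Main.v *)
Require Import Defs.
From mathcomp Require Import all_boot all_order all_algebra.
From mathcomp Require Import all_classical all_reals all_analysis.
From mathcomp Require Import measurable_realfun ring lra.

(** The left-hand side is what integration by parts makes of the right-hand
    side. Put m for the midpoint and h for half of the length. The affine maps
    y = m - h * t and y = m + h * t turn the two integrals on the right into
    h^-1 * h^-alpha times
      int_(theta1..m) w f'   and   int_(m..theta2) w f',
    where, on an interval [a, b], w y = (y - a)^alpha - (b - y)^alpha
    ([powR_gap]). This weight takes the values -(b - a)^alpha and (b - a)^alpha
    at the endpoints, and its derivative is alpha times the sum of the two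
    kernels of the fractional integrals. Integration by parts therefore yields
    the values of f at theta1, m and theta2, and the four fractional integrals
    ([powR_gap_by_parts]). The terms in 1 - alpha on the left cancel, and
    Gamma alpha cancels because it is a finite positive number ([Gamma_gt0]).

    The derivative of f is only square integrable and the derivative of w is
    unbounded when alpha < 1, so the integration by parts has to be the one
    for absolutely continuous functions ([absolutely_continuous_by_parts]).
    Since products of absolutely continuous functions are absolutely
    continuous, it reduces to the fundamental theorem of calculus
    [absolutely_continuous_FTC]. There, F minus the indefinite integral of F'
    is absolutely continuous with zero derivative almost everywhere, by
    Lebesgue differentiation. Such a function H is constant
    ([absolutely_continuous_derive0]): cover the exceptional null set by an
    open set U of small measure; then [a, b] can be walked through in steps
    which either stay close to a point of zero derivative, where H changes by
    at most e times the length of the step, or lie in U, where the total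
    change is small by absolute continuity ([increment_chain]).

    Absolute continuity of w holds because y^alpha is the indefinite integral
    of the integrable function alpha * y^(alpha - 1), and the change of
    variables for merely integrable functions comes from the fact that
    taking preimages under an affine map of slope s divides Lebesgue measure
    by |s| ([lebesgue_measure_affine]). *)

Set Implicit Arguments.
Unset Strict Implicit.
Unset Printing Implicit Defensive.

Import Order.TTheory GRing.Theory Num.Theory.
Import numFieldNormedType.Exports.

Local Open Scope classical_set_scope.
Local Open Scope ring_scope.

(** * Absolutely continuous functions *)

Lemma absolutely_continuousB {R : realType} (a b : R) (f g : R -> R) :
  absolutely_continuous a b f -> absolutely_continuous a b g ->
  absolutely_continuous a b (fun x => f x - g x).
Proof.
move=> acf acg e e0; have e20 : 0 < e / 2 by rewrite divr_gt0.
have [d1 d10 fd] := acf _ e20; have [d2 d20 gd] := acg _ e20.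
exists (Num.min d1 d2) => [|n u v uv tuv]; first by rewrite lt_min d10.
rewrite lt_min => /andP[ud1 ud2].
apply: (@le_lt_trans _ _ (\sum_(i < n) `|f (v i) - f (u i)| +
                          \sum_(i < n) `|g (v i) - g (u i)|)).
  rewrite -big_split/=; apply: ler_sum => i _.
  rewrite (_ : _ - _ = (f (v i) - f (u i)) - (g (v i) - g (u i))); last by ring.
  exact: ler_normB.
by rewrite [e]splitr ltrD// ?fd ?gd.
Qed.

Lemma absolutely_continuousS {R : realType} (a b c d : R) (f : R -> R) :
  a <= c -> d <= b -> absolutely_continuous a b f -> absolutely_continuous c d f.
Proof.
move=> ac db acf e e0; have [h h0 fh] := acf _ e0.
exists h => // n u v uv; apply: fh => i; have [? [? ?]] := uv i.
by do !split => //; [exact: le_trans ac _|exact: le_trans db].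
Qed.

Lemma measure_disjoint_itv {R : realType} (n : nat) (u v : 'I_n -> R) :
  (forall i, u i <= v i) ->
  trivIset [set: 'I_n] (fun i => `]u i, v i[%classic) ->
  lebesgue_measure (\big[setU/set0]_(i < n) `]u i, v i[%classic) =
  (\sum_(i < n) (v i - u i))%:E.
Proof.
move=> uv tuv; rewrite measure_bigsetU_ord//= -sumEFin.
apply: eq_bigr => i _; rewrite lebesgue_measure_itv/= lte_fin.
case: ltP => // vu.
have /le_anti -> : u i <= v i <= u i by rewrite uv vu.
by rewrite subrr.
Qed.

(** Only the total mass of |K| over the small set swept by the intervals
    matters, so this is the absolute continuity of the integral as a set
    function. *)
Lemma absolutely_continuous_integral {R : realType} (a b : R) (K : R -> R) :
  lebesgue_measure.-integrable [set: R] (EFin \o K) ->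
  absolutely_continuous a b
    (fun x => \int[lebesgue_measure]_(t in `]-oo, x]%classic) K t).
Proof.
move=> iK e e0.
have [d [d0 Kd]] := integral_normr_continuous iK e0.
exists d => // n u v uv tuv uvd.
have uv' i : u i <= v i by have [_ []] := uv i.
have mitv i : measurable (`]u i, v i[%classic : set (measurableTypeR R)).
  exact: measurable_itv.
pose D := \big[setU/set0]_(i < n) `]u i, v i[%classic.
have mD : measurable (D : set (measurableTypeR R)).
  by apply: bigsetU_measurable => i _; exact: mitv.
have : \int[lebesgue_measure]_(x in D) `|K x| < e.
  have Dd : (lebesgue_measure D < d%:E)%E.
    by rewrite measure_disjoint_itv// lte_fin.
  exact: Kd Dd.
apply: le_lt_trans.
have inK : lebesgue_measure.-integrable [set: R] (EFin \o (fun x => `|K x|)).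
  exact: (integrable_abse iK).
have -> : \int[lebesgue_measure]_(x in D) `|K x| =
    \sum_(i < n) \int[lebesgue_measure]_(x in `]u i, v i[%classic) `|K x|.
  rewrite /Rintegral ge0_integral_bigsetU//=.
  - rewrite -[RHS]/(fine (EFin _)) -sumEFin; congr fine.
    apply: eq_bigr => i _; rewrite fineK//.
    by apply: integrable_fin_num => //; exact: integrableS inK.
  - exact: index_enum_uniq.
  - exact: sub_trivIset tuv.
  - by move/integrableP : (integrableS measurableT mD (@subsetT _ _) inK) => [].
apply: ler_sum => i _.
rewrite (@Rintegral_itvB R K -oo%O (BRight (v i)) (u i))//; last 2 first.
- by apply: integrableS iK.
- by rewrite bnd_simp.
apply: (le_trans (le_normr_Rintegral _ _)) => //; first exact: integrableS iK.
rewrite Rintegral_itv_bndo_bndc//.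
by apply: integrableS inK.
Qed.

Lemma absolutely_continuous_shift {R : realType} (a b c : R) (f : R -> R) :
  absolutely_continuous a b f ->
  absolutely_continuous (a + c) (b + c) (fun x => f (x - c)).
Proof.
move=> acf e e0; have [d d0 fd] := acf e e0.
exists d => // n u v uv tuv uvd.
apply: (fd n (fun i => u i - c) (fun i => v i - c)) => //.
- by move=> i; have [? [? ?]] := uv i; do !split; lra.
- apply/trivIsetP => i j _ _ ij; move/trivIsetP : tuv => /(_ i j I I ij).
  rewrite -!subset0 => uvij x/=; rewrite !in_itv/= => -[/andP[? ?] /andP[? ?]].
  by apply: (uvij (x + c)); rewrite /= !in_itv/=; split; apply/andP; split; lra.
- by under eq_bigr do rewrite opprB addrA subrK.
Qed.

Lemma absolutely_continuous_reflect {R : realType} (a b : R) (f : R -> R) :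
  absolutely_continuous a b f ->
  absolutely_continuous a b (fun x => f (a + b - x)).
Proof.
move=> acf e e0; have [d d0 fd] := acf e e0.
exists d => // n u v uv tuv uvd.
under eq_bigr do rewrite distrC.
apply: (fd n (fun i => a + b - v i) (fun i => a + b - u i)) => //.
- by move=> i; have [? [? ?]] := uv i; do !split; lra.
- apply/trivIsetP => i j _ _ ij; move/trivIsetP : tuv => /(_ i j I I ij).
  rewrite -!subset0 => uvij x/=; rewrite !in_itv/= => -[/andP[? ?] /andP[? ?]].
  apply: (uvij (a + b - x)); rewrite /= !in_itv/=.
  by split; apply/andP; split; lra.
- rewrite (eq_bigr (fun i => v i - u i))// => i _; ring.
Qed.

Lemma absolutely_continuous_continuous {R : realType} (a b : R) (f : R -> R) :
  absolutely_continuous a b f -> {within `[a, b], continuous f}.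
Proof.
move=> acf; apply/subspace_continuousP => x; rewrite /= in_itv/= => /andP[ax xb].
apply/cvgrPdist_lt => e e0; have [d d0 fd] := acf e e0.
rewrite near_withinE; apply/nbhs_ballP; exists d => //= y.
rewrite /ball/= in_itv/= => xyd /andP[ay yb].
wlog xy : x y ax xb ay yb xyd / x <= y.
  move=> wl; have [|/ltW] := leP x y; first exact: wl.
  by rewrite distrC; apply: wl; rewrite // distrC.
rewrite distrC.
have := fd 1%N (fun=> x) (fun=> y); rewrite !big_ord1; apply.
- by [].
- by apply/trivIsetP => i j _ _; rewrite !ord1 eqxx.
- by rewrite distrC in xyd; rewrite (le_lt_trans (ler_norm _)).
Qed.

Lemma absolutely_continuous_bounded {R : realType} (a b : R) (f : R -> R) :
  a <= b -> absolutely_continuous a b f ->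
  exists M : R, forall x, a <= x <= b -> `|f x| <= M.
Proof.
move=> ab /absolutely_continuous_continuous cf.
have cnf : {within `[a, b], continuous (fun x => `|f x|)}.
  by move=> x; apply: cvg_norm; exact: cf.
have [c cab fc] := EVT_max ab cnf.
by exists `|f c| => x xab; apply: fc; rewrite in_itv.
Qed.

(** Both factors are bounded on the compact interval, and
    f v g v - f u g u = (f v - f u) g v + f u (g v - g u). *)
Lemma absolutely_continuousM {R : realType} (a b : R) (f g : R -> R) :
  a <= b -> absolutely_continuous a b f -> absolutely_continuous a b g ->
  absolutely_continuous a b (fun x => f x * g x).
Proof.
move=> ab acf acg e e0.
have [Mf fM] := absolutely_continuous_bounded ab acf.
have [Mg gM] := absolutely_continuous_bounded ab acg.
pose M := 1 + `|Mf| + `|Mg|.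
have M0 : 0 < M by rewrite /M -addrA ltr_wpDr.
have {}fM x : a <= x <= b -> `|f x| <= M.
  by move=> /fM; have := ler_norm Mf; have := normr_ge0 Mg; rewrite /M; lra.
have {}gM x : a <= x <= b -> `|g x| <= M.
  by move=> /gM; have := ler_norm Mg; have := normr_ge0 Mf; rewrite /M; lra.
have eM0 : 0 < e / (M *+ 2) by rewrite divr_gt0// pmulrn_lgt0.
have [d1 d10 fd] := acf _ eM0; have [d2 d20 gd] := acg _ eM0.
exists (Num.min d1 d2) => [|n u v uv tuv]; first by rewrite lt_min d10.
rewrite lt_min => /andP[ud1 ud2].
apply: (@le_lt_trans _ _ (M * \sum_(i < n) `|f (v i) - f (u i)| +
                          M * \sum_(i < n) `|g (v i) - g (u i)|)).
  rewrite !mulr_sumr -big_split/=; apply: ler_sum => i _.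
  have [au [uvi vb]] := uv i.
  rewrite (_ : _ - _ = (f (v i) - f (u i)) * g (v i) +
                       f (u i) * (g (v i) - g (u i))); last by ring.
  rewrite (le_trans (ler_normD _ _))// !normrM [X in X + _]mulrC.
  rewrite lerD// ler_wpM2r//.
    by rewrite gM// vb andbT (le_trans au).
  by rewrite fM// au (le_trans uvi).
have -> : e = M * (e / (M *+ 2)) + M * (e / (M *+ 2)).
  by field; rewrite gt_eqF.
by rewrite ltrD// ltr_pM2l// ?fd ?gd.
Qed.

(** * Fundamental theorem of calculus under absolute continuity *)

Lemma derive0_increment_le {R : realType} (H : R -> R) (x e : R) :
  is_derive x 1 H 0 -> 0 < e ->
  exists2 r : R, 0 < r & forall y, `|y - x| < r ->
    `|H y - H x| <= e * `|y - x|.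
Proof.
move=> [dH H0] e0; move: dH; rewrite /derivable => dH.
have {H0}cH : h^-1 *: ((H \o shift x) (h *: 1) - H x) @[h --> 0^'] --> (0 : R).
  by rewrite -[X in _ --> X]H0; exact: dH.
move/cvgrPdist_le : cH => /(_ _ e0)/nbhs_ballP[r /= r0 rH].
exists r => // y yx; have [->|ynx] := eqVneq y x.
  by rewrite !subrr normr0 mulr0.
have yx0 : y - x != 0 by rewrite subr_eq0.
have := rH (y - x); rewrite /ball/= sub0r normrN => /(_ yx yx0).
rewrite /= sub0r normrN normrZ normfV [_ *: 1]mulr1 subrK ler_pdivrMl.
  by rewrite mulrC.
by rewrite normr_gt0.
Qed.

(** A continuous induction, as in the proof of Cousin's lemma. The points that can
    be reached from a by finitely many admissible steps have a supremum c, and the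
    neighbourhood attached to c allows one to step onto c, and then past it
    unless c = b. The intervals [u i, v i] record the steps made inside U. *)
Lemma increment_chain {R : realType} (a b e : R) (H : R -> R) (U : set R) :
  a <= b -> 0 <= e ->
  (forall x, a <= x <= b ->
     (exists2 r : R, 0 < r & forall y, `|y - x| < r ->
        `|H y - H x| <= e * `|y - x|) \/
     (exists2 r : R, 0 < r & forall y, `|y - x| < r -> U y)) ->
  exists (n : nat) (u v : nat -> R), [/\
    forall i, (i < n)%N ->
      [/\ a <= u i, u i <= v i, v i <= b & forall y, u i <= y <= v i -> U y],
    forall i j, (i < j)%N -> (j < n)%N -> v i <= u j &
    `|H b - H a| <= e * (b - a) + \sum_(i < n) `|H (v i) - H (u i)|].
Proof.
move=> ab e0 loc.
(* P x: the point x is reached from a by admissible steps *)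
pose P x := exists (n : nat) (u v : nat -> R), [/\
    forall i, (i < n)%N ->
      [/\ a <= u i, u i <= v i, v i <= x & forall y, u i <= y <= v i -> U y],
    forall i j, (i < j)%N -> (j < n)%N -> v i <= u j &
    `|H x - H a| <= e * (x - a) + \sum_(i < n) `|H (v i) - H (u i)|].
rewrite -/(P b).
have step_flat x y : x <= y -> P x -> `|H y - H x| <= e * (y - x) -> P y.
  move=> xy [n [u [v [uv vu Hx]]]] Hxy; exists n, u, v; split => //.
    by move=> i /uv[? ? vx ?]; split => //; exact: le_trans xy.
  rewrite (_ : H y - H a = (H y - H x) + (H x - H a)); last by ring.
  rewrite (_ : e * (y - a) = e * (y - x) + e * (x - a)); last by ring.
  by rewrite (le_trans (ler_normD _ _))// -addrA lerD.
have step_U x y : a <= x -> x <= y -> P x -> (forall z, x <= z <= y -> U z) ->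
    P y.
  move=> ax xy [n [u [v [uv vu Hx]]]] xyU.
  exists n.+1, (fun i => if i == n then x else u i),
    (fun i => if i == n then y else v i); split.
  - move=> i; rewrite ltnS leq_eqVlt; case: eqVneq => //= _ /uv[? ? vx ?].
    by split => //; exact: le_trans xy.
  - move=> i j ij; rewrite ltnS leq_eqVlt => /predU1P[jn|jn].
      have iltn : (i < n)%N by rewrite -jn.
      by rewrite jn eqxx (ltn_eqF iltn); have [] := uv i iltn.
    by rewrite (ltn_eqF jn) (ltn_eqF (ltn_trans ij jn)); exact: vu.
  - rewrite big_ord_recr/= eqxx.
    under eq_bigr => i _ do rewrite (ltn_eqF (ltn_ord i)).
    rewrite (_ : H y - H a = (H x - H a) + (H y - H x)); last by ring.
    rewrite (le_trans (ler_normD _ _))// addrA lerD// (le_trans Hx)// lerD2r.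
    by rewrite ler_wpM2l// lerD2r.
have Pa : P a.
  exists 0%N, (fun=> a), (fun=> a); split => //.
  by rewrite !subrr normr0 mulr0 big_ord0 addr0.
pose S := [set x | a <= x <= b /\ P x].
have Sa : S a by rewrite /S/= lexx.
have supS : has_sup S.
  by split; [exists a|exists b => x [/andP[]]].
pose c := sup S.
have ac : a <= c by apply: ub_le_sup => //; exact: supS.2.
have cb : c <= b by apply: ge_sup; [exists a|move=> x [/andP[]]].
have [r r0 Pr] : exists2 r : R, 0 < r & forall x y, a <= x -> x <= y ->
    (x = c \/ y = c) -> y - x < r -> P x -> P y.
  have acb : a <= c <= b by rewrite ac.
  have [[r r0 Hr]|[r r0 Hr]] := loc c acb; exists r => //.
  - move=> x y ax xy xyc yxr Px; apply: (step_flat x) => //.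
    have := ger0_norm (_ : 0 <= y - x); rewrite subr_ge0 => /(_ xy) nyx.
    case: xyc => cE; first by rewrite -nyx cE; apply: Hr; rewrite -cE nyx.
    by rewrite -nyx distrC cE (distrC c) ; apply: Hr; rewrite -cE distrC nyx.
  - move=> x y ax xy xyc yxr Px; apply: (step_U x) => // z /andP[xz zy].
    by apply: Hr; rewrite ltr_norml; case: xyc => <-; apply/andP; split; lra.
have Pc : P c.
  have [x [/andP[ax xb] Px] cx] := sup_adherent r0 supS.
  have xc : x <= c by apply: ub_le_sup; [exact: supS.2|split => //; rewrite ax].
  by apply: (Pr x) => //; [right|rewrite ltrBlDr -ltrBlDl].
have [<-//|cltb] := eqVneq c b.
have {cltb} cltb : c < b by rewrite lt_neqAle cltb.
pose y := Num.min b (c + r / 2).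
have cy : c < y by rewrite lt_min cltb ltrDl divr_gt0.
have Sy : S y.
  split; first by rewrite (le_trans ac (ltW cy)) ge_min lexx.
  apply: (Pr c) => //; [exact: ltW|by left|].
  by rewrite ltrBlDl gt_min; apply/orP; right; lra.
by have := ub_le_sup supS.2 Sy; rewrite leNgt cy.
Qed.

(** The Cantor function shows that continuity is not enough. Here the
    contribution of the exceptional null set N is controlled by covering N
    with an open set of measure less than the modulus of absolute continuity
    of H. The endpoints are put into N because nothing is assumed about the
    derivative there. *)
Lemma absolutely_continuous_derive0 {R : realType} (a b : R) (H : R -> R) :
  a <= b -> absolutely_continuous a b H ->
  {ae lebesgue_measure, forall x : R, a < x < b -> is_derive x 1 H 0} ->
  H b = H a.
Proof.
move=> ab acH aeH; apply/eqP; rewrite -subr_eq0 -normr_eq0 eq_le normr_ge0 andbT.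
apply/ler_addgt0Pr => e' e'0; rewrite add0r.
have ba10 : 0 < b - a + 1 by rewrite ltr_wpDl// subr_ge0.
pose e := e' / (b - a + 1).
have e0 : 0 < e by rewrite divr_gt0.
have -> : e' = e * (b - a) + e by rewrite /e; field; rewrite gt_eqF.
have [d d0 Hd] := acH _ e0.
pose N : set R := ~` [set x | a < x < b -> is_derive x 1 H 0] `|` [set a]
  `|` [set b].
have negN : (@lebesgue_measure R).-negligible N.
  apply: negligibleU; first apply: negligibleU => //.
    by apply/negligibleP => //; exact: lebesgue_measure_set1.
  by apply/negligibleP => //; exact: lebesgue_measure_set1.
have d20 : 0 < d / 2 by rewrite divr_gt0.
have [U [oU NU Ud]] := outer_measure_open_le N d20.
move: Ud; move/negligible_outer_measure : (negN) => ->; rewrite add0e => Ud.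
have [x xab|n [u [v [uv vu Hab]]]] := @increment_chain _ a b e H U ab (ltW e0).
  have [Nx|/not_orP[/not_orP[/contrapT Hx xa] xb]] := pselect (N x).
    right; have /nbhs_ballP[r /= r0 rU] : nbhs x U.
      by apply: open_nbhs_nbhs; split => //; exact: NU.
    by exists r => // y yx; apply: rU; rewrite /ball/= distrC.
  left; apply: derive0_increment_le => //; apply: Hx.
  case/andP: xab => ax xb'; rewrite !lt_neqAle ax xb' !andbT.
  by apply/andP; split; apply/eqP => xE; [apply: xa|apply: xb].
apply: (le_trans Hab); rewrite lerD2l ltW//.
have uv' (i : 'I_n) : u i <= v i by have [] := uv i (ltn_ord i).
have tuv : trivIset [set: 'I_n] (fun i => `]u i, v i[%classic).
  apply/trivIsetP => i j _ _ ij.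
  wlog ltij : i j ij / (i < j)%N.
    move=> wl; have [|ji|/val_inj ji] := ltngtP i j; first exact: wl.
      by rewrite setIC; apply: wl; rewrite // eq_sym.
    by rewrite ji eqxx in ij.
  rewrite -subset0 => x []/=; rewrite !in_itv/= => /andP[_ xv] /andP[ux _].
  have := vu i j ltij (ltn_ord j).
  by rewrite leNgt (lt_trans ux xv).
apply: (Hd _ (fun i => u i) (fun i => v i)) => //.
  by move=> i; have [] := uv i (ltn_ord i).
rewrite -lte_fin -measure_disjoint_itv//.
apply: (@le_lt_trans _ _ (lebesgue_measure U)); last first.
  by rewrite (le_lt_trans Ud)// lte_fin ltr_pdivrMr// ltr_pMr// ltr1n.
apply: le_measure; rewrite ?inE.
- by apply: bigsetU_measurable => i _; exact: measurable_itv.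
- exact: open_measurable.
- apply: (big_ind (fun A => A `<=` U)) => [//|A B AU BU|i _ x].
    by rewrite subUset.
  rewrite /= in_itv/= => /andP[ux xv].
  by have [_ _ _] := uv i (ltn_ord i); apply; rewrite !ltW.
Qed.

(** The derivative of a function given on [a, b] is only meaningful in the
    interior, so hypotheses concern ]a, b[ while integrals are written over
    [a, b]; the next three lemmas pass between the two. *)
Lemma integral_itvoo_cc {R : realType} (a b : R) (f : R -> \bar R) :
  measurable_fun `]a, b[%classic f ->
  (\int[lebesgue_measure]_(x in `]a, b[%classic) f x =
   \int[lebesgue_measure]_(x in `[a, b]%classic) f x)%E.
Proof.
move=> mf; rewrite integral_itv_bndo_bndc// integral_itv_obnd_cbnd//.
exact/emeasurable_fun_itv_bndo_bndcP.
Qed.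

Lemma integrable_itvoo_cc {R : realType} (a b : R) (f : R -> \bar R) :
  lebesgue_measure.-integrable `]a, b[%classic f ->
  lebesgue_measure.-integrable `[a, b]%classic f.
Proof.
move=> /integrableP[mf fi]; apply/integrableP; split.
  exact/emeasurable_fun_itv_obnd_cbndP/emeasurable_fun_itv_bndo_bndcP.
by rewrite -integral_itvoo_cc//; exact: measurableT_comp.
Qed.

Lemma Rintegral_itvoo_cc {R : realType} (a b : R) (f : R -> R) :
  measurable_fun `]a, b[%classic f ->
  \int[lebesgue_measure]_(x in `]a, b[%classic) f x =
  \int[lebesgue_measure]_(x in `[a, b]%classic) f x.
Proof.
by move=> mf; rewrite /Rintegral integral_itvoo_cc//; exact/measurable_EFinP.
Qed.

(** F and the indefinite integral G of F' have the same derivative almost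
    everywhere, by the Lebesgue differentiation theorem, and both are
    absolutely continuous; hence F - G is constant. *)
Lemma absolutely_continuous_FTC {R : realType} (a b : R) (F : R -> R) :
  a < b -> absolutely_continuous a b F ->
  (forall x, a < x < b -> derivable F x 1) ->
  lebesgue_measure.-integrable `]a, b[%classic (EFin \o derive1 F) ->
  \int[lebesgue_measure]_(x in `[a, b]%classic) derive1 F x = F b - F a.
Proof.
move=> ab acF dF iF'.
pose K := (derive1 F : R -> R) \_ `]a, b[.
have iK : lebesgue_measure.-integrable [set: R] (EFin \o K).
  by rewrite /K -restrict_EFin; apply/integrable_restrict => //; rewrite setTI.
pose G x := \int[lebesgue_measure]_(t in `]-oo, x]%classic) K t.
have aeG : {ae lebesgue_measure,
    forall x : R, derivable G x 1 /\ derive1 G x = K x}.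
  apply: FTC1Ny; first by move=> y; exact: integrableS iK.
  by apply: open_integrable_locally => //; exact: openT.
have GF : F b - G b = F a - G a.
  apply: (@absolutely_continuous_derive0 _ a b (fun x => F x - G x)).
  - exact: ltW.
  - apply: absolutely_continuousB => //.
    exact: absolutely_continuous_integral.
  - move: aeG; apply: filterS; first
      exact: (ae_filter_ringOfSetsType (@lebesgue_measure R)).
    move=> x [dG G'] xab.
    have dFx := dF x xab; have Kx : K x = derive1 F x.
      by rewrite /K patchE mem_set//= in_itv.
    have -> : 0 = 'D_1 F x - 'D_1 G x.
      by rewrite -!derive1E G' Kx subrr.
    exact: is_deriveB.
have mF' : measurable_fun `]a, b[%classic (derive1 F).
  by move/integrableP : iF' => [/measurable_EFinP].
have KF : \int[lebesgue_measure]_(x in `]a, b[%classic) derive1 F x =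
    \int[lebesgue_measure]_(x in `]a, b]%classic) K x.
  rewrite -(@Rintegral_itv_bndo_bndc R (BRight a) b K); last first.
    exact: integrableS iK.
  by apply: eq_Rintegral => x xab; rewrite /K patchE xab.
rewrite -Rintegral_itvoo_cc// KF -(@Rintegral_itvB R K -oo%O (BRight b) a)//.
- by rewrite -/(G b) -/(G a); move: GF; lra.
- exact: integrableS iK.
- by rewrite bnd_simp ltW.
Qed.

(** * Integration by parts for absolutely continuous functions *)

Lemma integrable_absolutely_continuousM {R : realType} (a b : R)
    (F k : R -> R) :
  a <= b -> absolutely_continuous a b F ->
  lebesgue_measure.-integrable `]a, b[%classic (EFin \o k) ->
  lebesgue_measure.-integrable `]a, b[%classic (EFin \o (fun x => F x * k x)).
Proof.
move=> ab acF ik; have [M FM] := absolutely_continuous_bounded ab acF.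
have mF : measurable_fun `]a, b[%classic F.
  apply: (@measurable_funS _ _ _ _ `[a, b]%classic) => //.
    exact: subset_itv_oo_cc.
  apply: subspace_continuous_measurable_fun => //.
  exact: absolutely_continuous_continuous.
rewrite [X in integrable _ _ X](_ : _ = (EFin \o F) \* (EFin \o k))%E; last first.
  by apply/funext => x /=; rewrite EFinM.
apply: integrableMr => //.
exists M; split; first exact: num_real.
move=> x Mx y /=; rewrite in_itv/= => /andP[ay yb].
by apply: (le_trans _ (ltW Mx)); apply: FM; rewrite !ltW.
Qed.

(** The fundamental theorem of calculus for the product F G. It covers
    unbounded derivatives, such as that of x^al at 0. *)
Lemma absolutely_continuous_by_parts {R : realType} (a b : R) (F G : R -> R) :
  a < b -> absolutely_continuous a b F -> absolutely_continuous a b G ->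
  (forall x, a < x < b -> derivable F x 1) ->
  (forall x, a < x < b -> derivable G x 1) ->
  lebesgue_measure.-integrable `]a, b[%classic (EFin \o derive1 F) ->
  lebesgue_measure.-integrable `]a, b[%classic (EFin \o derive1 G) ->
  \int[lebesgue_measure]_(x in `[a, b]%classic) (F x * derive1 G x) =
  F b * G b - F a * G a -
  \int[lebesgue_measure]_(x in `[a, b]%classic) (G x * derive1 F x).
Proof.
move=> ab acF acG dF dG iF iG.
have iFG := integrable_absolutely_continuousM (ltW ab) acF iG.
have iGF := integrable_absolutely_continuousM (ltW ab) acG iF.
pose P x := F x * G x.
have dP x : a < x < b ->
    is_derive x 1 P (F x * derive1 G x + G x * derive1 F x).
  move=> xab; have := dF x xab; have := dG x xab => dGx dFx.
  by rewrite !derive1E; apply: is_deriveM.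
have P'E : {in `]a, b[%classic,
    (fun x => F x * derive1 G x + G x * derive1 F x) =1 derive1 P}.
  move=> x; rewrite inE/= in_itv/= => /dP xP.
  by rewrite [RHS]derive1E (@derive_val _ _ _ _ _ _ _ xP).
have iP : lebesgue_measure.-integrable `]a, b[%classic (EFin \o derive1 P).
  have mab : measurable (`]a, b[%classic : set (measurableTypeR R)) by [].
  have := integrableD mab iFG iGF.
  by apply: eq_integrable => // x xab /=; rewrite -P'E.
have : \int[lebesgue_measure]_(x in `[a, b]%classic) derive1 P x = P b - P a.
  apply: absolutely_continuous_FTC => //; last by move=> x /dP[].
  exact: absolutely_continuousM (ltW ab) acF acG.
have mE (h : R -> R) : lebesgue_measure.-integrable `]a, b[%classic (EFin \o h)
    -> measurable_fun `]a, b[%classic h.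
  by move=> /integrableP[/measurable_EFinP].
rewrite -!Rintegral_itvoo_cc; [|exact: mE..].
rewrite -(eq_Rintegral (@lebesgue_measure R) P'E) RintegralD// /P => PE.
by rewrite -PE addrK.
Qed.

(** * Affine change of variables in Lebesgue integrals *)

Lemma measurable_affine {R : realType} (c s : R) :
  measurable_fun [set: measurableTypeR R]
    (fun x : measurableTypeR R => c + s * x : measurableTypeR R).
Proof.
by apply: measurable_funD => //; exact: measurable_funM.
Qed.

(** Both sides are measures in A, and they agree on the intervals ]u, v]. For
    s < 0 the preimage of such an interval is closed on the left and open on
    the right, which does not change its length. *)
Lemma lebesgue_measure_affine {R : realType} (c s : R)
    (A : set (measurableTypeR R)) : s != 0 -> measurable A ->
  (lebesgue_measure A =
   `|s|%:E * lebesgue_measure ((fun x : R => c + s * x)%R @^-1` A))%E.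
Proof.
move=> s0 mA.
have ns0 : 0 < `|s| by rewrite normr_gt0.
have [nu nuE] : exists nu : {measure set (measurableTypeR R) -> \bar R},
    forall B, nu B = (`|s|%:E * lebesgue_measure
      ((fun x : R => c + s * x)%R @^-1` B))%E.
  unshelve refine (ex_intro _ (mscale (NngNum (ltW ns0))
    (pushforward (@lebesgue_measure R) (fun x : measurableTypeR R =>
      c + s * x : measurableTypeR R) : {measure set _ -> \bar R})
    : {measure set _ -> \bar R}) _) => //.
  exact: measurable_affine.
rewrite -nuE; apply: lebesgue_measure_unique => //= _ [[a b]] _ <-.
rewrite nuE.
have [sgt0|slt0] : 0 < s \/ s < 0 by move: s0; rewrite neq_lt => /orP[]; tauto.
  have -> : (fun x : R => c + s * x) @^-1` `]a, b]%classic =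
      `](a - c) / s, (b - c) / s]%classic.
    apply/seteqP; split => x /=; rewrite !in_itv/= ltr_pdivrMr// ler_pdivlMr//.
      by move=> /andP[? ?]; apply/andP; split; lra.
    by move=> /andP[? ?]; apply/andP; split; lra.
  rewrite !lebesgue_measure_itv/= !lte_fin ltr_pM2r ?invr_gt0// ltrD2r.
  case: ifPn => _; last by rewrite mule0.
  by rewrite -EFinM gtr0_norm//; congr EFin; field; rewrite gt_eqF.
have -> : (fun x : R => c + s * x) @^-1` `]a, b]%classic =
    `[(b - c) / s, (a - c) / s[%classic.
  apply/seteqP; split => x /=; rewrite !in_itv/= ltr_ndivlMr// ler_ndivrMr//.
    by move=> /andP[? ?]; apply/andP; split; lra.
  by move=> /andP[? ?]; apply/andP; split; lra.
rewrite !lebesgue_measure_itv/= !lte_fin ltr_nM2r ?invr_lt0// ltrD2r.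
case: ifPn => _; last by rewrite mule0.
by rewrite -EFinM ltr0_norm//; congr EFin; field; rewrite lt_eqF.
Qed.

Lemma ge0_integral_affine {R : realType} (c s : R) (f : R -> \bar R) :
  s != 0 -> measurable_fun [set: measurableTypeR R] f ->
  (forall x, (0 <= f x)%E) ->
  (\int[lebesgue_measure]_x f x =
   `|s|%:E * \int[lebesgue_measure]_x f (c + s * x)%R)%E.
Proof.
move=> s0 mf f0.
have ns0 : 0 < `|s| by rewrite normr_gt0.
rewrite -[X in (_ * X)%E](@ge0_integral_pushforward _ _ _ _ R _
  (measurable_affine c s) _ setT f)//.
rewrite -(ge0_integral_mscale _ _ (NngNum (ltW ns0)))//.
  exact: measurable_affine.
move=> mphi; apply: eq_measure_integral => A mA _.
exact: (lebesgue_measure_affine c s0 mA).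
Qed.

Lemma integrable_affine {R : realType} (c s : R) (D : set R) (f : R -> R) :
  s != 0 -> measurable (D : set (measurableTypeR R)) ->
  lebesgue_measure.-integrable D (EFin \o f) ->
  lebesgue_measure.-integrable ((fun x => c + s * x) @^-1` D)
    (EFin \o (fun x => f (c + s * x))).
Proof.
move=> s0 mD ifD.
have mphiD : measurable ((fun x : R => c + s * x) @^-1` D
    : set (measurableTypeR R)).
  by rewrite -[X in measurable X]setTI; exact: measurable_affine.
have := ifD; rewrite integrable_mkcond// => /integrableP[mfD fiD].
rewrite integrable_mkcond//.
have -> : (EFin \o (fun x => f (c + s * x)))
      \_ ((fun x => c + s * x) @^-1` D) =
    (EFin \o f) \_ D \o (fun x => c + s * x).
  by apply/funext => x; rewrite !patchE/=.
apply/integrableP; split; first exact: measurableT_comp (measurable_affine c s).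
rewrite (ge0_integral_affine c s0) in fiD => //; last first.
  exact: measurableT_comp.
have ns0 : (0 < `|s|%:E :> \bar R)%E by rewrite lte_fin normr_gt0.
set I := (X in (X < _)%E); have {}fiD : (`|s|%:E * I < +oo)%E := fiD.
by move: fiD; case: I => [r _||_]; rewrite ?ltry ?ltNyr// gt0_muley.
Qed.

Lemma Rintegral_affine {R : realType} (c s : R) (D : set R) (f : R -> R) :
  s != 0 -> measurable (D : set (measurableTypeR R)) ->
  lebesgue_measure.-integrable D (EFin \o f) ->
  \int[lebesgue_measure]_(x in (fun x => c + s * x) @^-1` D) f (c + s * x) =
  `|s|^-1 * \int[lebesgue_measure]_(x in D) f x.
Proof.
move=> s0 mD ifD.
have mphiD : measurable ((fun x : R => c + s * x) @^-1` D
    : set (measurableTypeR R)).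
  by rewrite -[X in measurable X]setTI; exact: measurable_affine.
have ns0 : `|s| != 0 by rewrite normr_eq0.
pose g := f \_ D.
have ig : lebesgue_measure.-integrable [set: R] (EFin \o g).
  by rewrite /g -restrict_EFin; apply/integrable_restrict => //; rewrite setTI.
have igs : lebesgue_measure.-integrable [set: R]
    (EFin \o (fun x => g (c + s * x))).
  by rewrite -(preimage_setT (fun x => c + s * x)); exact: integrable_affine.
rewrite Rintegral_mkcond [in RHS]Rintegral_mkcond.
have -> : (fun x => f (c + s * x)) \_ ((fun x => c + s * x) @^-1` D) =
    (fun x => g (c + s * x)).
  by apply/funext => x; rewrite /g !patchE.
apply: (mulfI ns0); rewrite mulrA divff// mul1r -/g.
have mg : measurable_fun [set: R] (EFin \o g) by case/integrableP : ig.
pose h := EFin \o g.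
have gE : (integral lebesgue_measure setT h =
    `|s|%:E * integral lebesgue_measure setT (h \o (fun x => c + s * x)%R))%E.
  rewrite integralE [in RHS]integralE muleBr//; last first.
    apply: fin_num_adde_defl; rewrite fin_numN.
    exact: integrable_neg_fin_num igs.
  congr (_ - _)%E.
    have mp : measurable_fun [set: measurableTypeR R] (h^\+)%E.
      exact: measurable_funepos.
    have p0 x : (0 <= (h^\+)%E x)%E by [].
    etransitivity; first exact: (ge0_integral_affine c s0 mp p0).
    by congr (_ * _)%E; apply: eq_integral => x _; rewrite !funeposE.
  have mn : measurable_fun [set: measurableTypeR R] (h^\-)%E.
    exact: measurable_funeneg.
  have n0 x : (0 <= (h^\-)%E x)%E by [].
  etransitivity; first exact: (ge0_integral_affine c s0 mn n0).
    by congr (_ * _)%E; apply: eq_integral => x _; rewrite !funenegE.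
rewrite [in RHS]/Rintegral gE fineM//.
exact: integrable_fin_num igs.
Qed.

(** * Powers as indefinite integrals *)

Lemma integral_powR_itvcc {R : realType} (al a b : R) : 0 < a -> a <= b ->
  (\int[lebesgue_measure]_(x in `[a, b]%classic) (al * x `^ (al - 1))%:E =
   (b `^ al - a `^ al)%:E)%E.
Proof.
move=> a0; rewrite le_eqVlt => /predU1P[<-|ab].
  by rewrite set_itv1 integral_set1 subrr.
have dpow (p x : R) : a <= x -> derivable (@powR R ^~ p) x 1.
  by move=> ax; have [] := is_derive1_powR p (lt_le_trans a0 ax).
have cpow (p x : R) : a <= x -> {for x, continuous (@powR R ^~ p)}.
  by move=> ax; apply/differentiable_continuous/derivable1_diffP/dpow.
rewrite (@continuous_FTC2 _ _ (@powR R ^~ al))//.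
- apply: derivable_within_continuous => x; rewrite in_itv/= => /andP[ax _].
  by apply: derivableM => //; exact: dpow.
- split.
  + by move=> x; rewrite in_itv/= => /andP[/ltW ax _]; exact: dpow.
  + by apply: cvg_at_right_filter; exact: cpow.
  + by apply: cvg_at_left_filter; exact/cpow/ltW.
- move=> x; rewrite in_itv/= => /andP[ax _].
  have /(@derive_val _ _ _ _ _ _ _) dx := is_derive1_powR al (lt_trans a0 ax).
  by rewrite derive1E dx.
Qed.

(** For al < 1 the integrand is unbounded near 0; the integral is the
    increasing limit of the integrals over [b / (n + 1), b], which the
    classical fundamental theorem of calculus evaluates. *)
Lemma integral_powR {R : realType} (al b : R) : 0 < al -> 0 < b ->
  (\int[lebesgue_measure]_(x in `]0%R, b]%classic) (al * x `^ (al - 1))%:E =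
   (b `^ al)%:E)%E.
Proof.
move=> al0 b0.
pose u (n : nat) : R := b * harmonic n.
have u0 n : 0 < u n by rewrite mulr_gt0// harmonic_gt0.
have ub n : u n <= b.
  by rewrite /u ger_pMr// invf_le1// ler1n.
pose F n := `[u n, b]%classic.
have mf (D : set R) : measurable D ->
    measurable_fun D (fun x : R => (al * x `^ (al - 1))%:E).
  move=> mD; apply/measurable_EFinP; apply: measurable_funM => //.
  by apply: measurable_funTS; exact: measurable_powR.
have Fu : \bigcup_n F n = `]0, b]%classic.
  apply/seteqP; split=> [x [n _]|x]; rewrite /F/= !in_itv/= => /andP[ux xb].
    by rewrite xb (lt_le_trans (u0 n)).
  have /cvgrPdist_lt/(_ (x / b) (divr_gt0 ux b0)) [N _ uN] := @cvg_harmonic R.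
  exists N => //=; rewrite in_itv/= xb andbT.
  have := uN N (leqnn N); rewrite sub0r normrN ger0_norm; last first.
    by rewrite harmonic_ge0.
  by rewrite ltr_pdivlMr// mulrC => /ltW.
have cF : (\int[lebesgue_measure]_(x in F n) (al * x `^ (al - 1))%:E)%E
    @[n --> \oo] -->
    (\int[lebesgue_measure]_(x in `]0%R, b]%classic) (al * x `^ (al - 1))%:E)%E.
  rewrite -Fu; apply: ge0_nondecreasing_set_cvg_integral => //.
  - move=> n m nm; apply/subsetPset => x; rewrite /F/= !in_itv/=.
    move=> /andP[ux ->]; rewrite andbT (le_trans _ ux)// ler_pM2l//.
    by rewrite lef_pV2 ?posrE// ler_nat ltnS.
  - by move=> n; exact: measurable_itv.
  - by move=> n; apply: mf; exact: measurable_itv.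
  - by move=> n x _; rewrite lee_fin mulr_ge0 ?powR_ge0// ltW.
have cF' : (\int[lebesgue_measure]_(x in F n) (al * x `^ (al - 1))%:E)%E
    @[n --> \oo] --> (b `^ al)%:E.
  under eq_cvg do rewrite integral_powR_itvcc//.
  apply: cvg_EFin; first by near=> n.
  rewrite -[X in _ --> X]subr0; apply: cvgB; first exact: cvg_cst.
  apply: (cvg_comp _ _ _ (powR_cvg0 al0)).
  have cu : u n @[n --> \oo] --> (0 : R).
    rewrite -(mulr0 b); apply: cvgM; first exact: cvg_cst.
    exact: cvg_harmonic.
  move=> A A0; have : \forall n \near \oo, 0 < u n -> A (u n) := cu _ A0.
  by apply: (@filterS _ \oo) => n; apply; exact: u0.
have := cvg_unique _ cF cF'; apply.
exact: ereal_hausdorff.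
Unshelve. all: by end_near. Qed.

Lemma integrable_powR {R : realType} (al b : R) : 0 < al -> 0 < b ->
  lebesgue_measure.-integrable `]0, b[%classic
    (EFin \o (fun x : R => x `^ (al - 1))).
Proof.
move=> al0 b0.
have mpow D : measurable_fun (D : set R) (fun x : R => x `^ (al - 1)).
  by apply: measurable_funTS; exact: measurable_powR.
pose k (x : R) := al * x `^ (al - 1).
have k0 x : 0 <= k x by rewrite mulr_ge0 ?powR_ge0// ltW.
have ik : lebesgue_measure.-integrable `]0, b]%classic (EFin \o k).
  apply/integrableP; split.
    by apply/measurable_EFinP; apply: measurable_funM => //; exact: mpow.
  under eq_integral do rewrite /= ger0_norm//.
  by rewrite integral_powR// ltry.
have {}ik : lebesgue_measure.-integrable `]0, b[%classic (EFin \o k).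
  by apply: integrableS ik => //; exact: subset_itv_oo_oc.
have mab : measurable (`]0, b[%classic : set (measurableTypeR R)) by [].
have := integrableZl mab al^-1 ik; apply: eq_integrable => // x _ /=.
by rewrite /k -EFinM mulrA mulVf ?mul1r// gt_eqF.
Qed.

(** The power function is the indefinite integral of its derivative, even when
    the latter blows up at 0. *)
Lemma absolutely_continuous_powR {R : realType} (al b : R) : 0 < al -> 0 < b ->
  absolutely_continuous 0 b (fun x => x `^ al).
Proof.
move=> al0 b0.
pose k : R -> R := (fun x : R => al * x `^ (al - 1)) \_ `]0, b[.
have ik : lebesgue_measure.-integrable [set: R] (EFin \o k).
  rewrite /k -restrict_EFin; apply/integrable_restrict => //; rewrite setTI.
  have mab : measurable (`]0, b[%classic : set (measurableTypeR R)) by [].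
  have := integrableZl mab al (integrable_powR al0 b0).
  by apply: eq_integrable => // x _ /=; rewrite EFinM.
pose G x := \int[lebesgue_measure]_(t in `]-oo, x]%classic) k t.
have GE x : 0 <= x <= b -> G x = x `^ al.
  move=> /andP[x0 xb].
  have -> : G x = \int[lebesgue_measure]_(t in `]0, x[%classic)
      (al * t `^ (al - 1)).
    rewrite /G -(@Rintegral_itv_bndo_bndc _ -oo%O x); last exact: integrableS ik.
    rewrite Rintegral_mkcond [RHS]Rintegral_mkcond.
    congr (Rintegral _ _ _); apply/funext => t; rewrite /k !patchE.
    rewrite !mem_setE !in_itv/=; case: ifPn => [tx|_]; last by rewrite andbF.
    by rewrite (lt_le_trans tx xb) andbT.
  have [->|xn0] := eqVneq x 0.
    by rewrite set_itvoo0 Rintegral_set0 powR0// gt_eqF.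
  have xgt0 : 0 < x by rewrite lt_neqAle eq_sym xn0.
  rewrite /Rintegral integral_itv_bndo_bndc ?integral_powR//.
  apply/measurable_EFinP; apply: measurable_funM => //.
  by apply: measurable_funTS; exact: measurable_powR.
move=> e e0; have [d d0 Gd] := absolutely_continuous_integral 0 b ik e0.
exists d => // n u v uv tuv uvd; have := Gd n u v uv tuv uvd.
rewrite (eq_bigr (fun i => `|v i `^ al - u i `^ al|))// => i _.
have [u0 [uvi vb]] := uv i; rewrite -/(G (v i)) -/(G (u i)).
by rewrite !GE ?u0 ?(le_trans u0)// (le_trans uvi).
Qed.

(** * Integration by parts against the fractional kernels *)

Lemma integrable_powR_left {R : realType} (al a b : R) : 0 < al -> a < b ->
  lebesgue_measure.-integrable `]a, b[%classic
    (EFin \o (fun y => (y - a) `^ (al - 1))).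
Proof.
move=> al0 ab; have ba0 : 0 < b - a by rewrite subr_gt0.
have mD : measurable (`]0, b - a[%classic : set (measurableTypeR R)) by [].
have := integrable_affine (- a) (oner_neq0 R) mD (integrable_powR al0 ba0).
rewrite (_ : _ @^-1` _ = `]a, b[%classic); last first.
  apply/seteqP; split => x/=; rewrite !in_itv/= => /andP[? ?];
  by apply/andP; split; lra.
by apply: eq_integrable => // x _ /=; rewrite mul1r addrC.
Qed.

Lemma integrable_powR_right {R : realType} (al a b : R) : 0 < al -> a < b ->
  lebesgue_measure.-integrable `]a, b[%classic
    (EFin \o (fun y => (b - y) `^ (al - 1))).
Proof.
move=> al0 ab; have ba0 : 0 < b - a by rewrite subr_gt0.
have mD : measurable (`]0, b - a[%classic : set (measurableTypeR R)) by [].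
have N10 : (-1 : R) != 0 by rewrite oppr_eq0 oner_eq0.
have := integrable_affine b N10 mD (integrable_powR al0 ba0).
rewrite (_ : _ @^-1` _ = `]a, b[%classic); last first.
  apply/seteqP; split => x/=; rewrite !in_itv/= => /andP[? ?];
  by apply/andP; split; lra.
by apply: eq_integrable => // x _ /=; rewrite mulN1r.
Qed.

(** The weight whose derivative is al times the sum of the kernels of the left
    and right fractional integrals of order al over [a, b]. *)
Definition powR_gap {R : realType} (al a b y : R) : R :=
  (y - a) `^ al - (b - y) `^ al.

Lemma absolutely_continuous_powR_gap {R : realType} (al a b : R) :
  0 < al -> a < b -> absolutely_continuous a b (powR_gap al a b).
Proof.
move=> al0 ab; have ba0 : 0 < b - a by rewrite subr_gt0.
have acl : absolutely_continuous a b (fun y => (y - a) `^ al).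
  have := absolutely_continuous_shift a (absolutely_continuous_powR al0 ba0).
  by rewrite add0r subrK.
apply: absolutely_continuousB => //.
have := absolutely_continuous_reflect acl.
rewrite (_ : (fun x => _) = (fun y => (b - y) `^ al))//.
by apply/funext => y; congr (_ `^ _); ring.
Qed.

Lemma is_derive_powR_gap {R : realType} (al a b y : R) : a < y < b ->
  is_derive y 1 (powR_gap al a b)
    (al * ((y - a) `^ (al - 1) + (b - y) `^ (al - 1))).
Proof.
move=> /andP[ay yb].
have ya0 : 0 < y - a by rewrite subr_gt0.
have by0 : 0 < b - y by rewrite subr_gt0.
have dl : is_derive y 1 (fun y => (y - a) `^ al) (al * (y - a) `^ (al - 1)).
  have dp := is_derive1_powR al ya0.
  have ds : is_derive y 1 (fun y => y - a) 1.
    by apply: is_derive_eq; rewrite subr0.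
  have := @is_derive1_comp R (@powR R ^~ al) (fun y => y - a) y _ _ dp ds.
  by rewrite mulr1.
have dr : is_derive y 1 (fun y => (b - y) `^ al) (- (al * (b - y) `^ (al - 1))).
  have dp := is_derive1_powR al by0.
  have ds : is_derive y 1 (fun y => b - y) (-1).
    by apply: is_derive_eq; rewrite add0r mul1r.
  have := @is_derive1_comp R (@powR R ^~ al) (fun y => b - y) y _ _ dp ds.
  by rewrite mulrN1.
rewrite (_ : _ * _ = al * (y - a) `^ (al - 1) - (- (al * (b - y) `^ (al - 1)))).
  exact: is_deriveB.
by ring.
Qed.

(** Integration by parts against the weight [powR_gap]; the boundary terms come
    with the same sign because the weight is odd about the midpoint. *)
Lemma powR_gap_by_parts {R : realType} (al a b : R) (f : R -> R) :
  0 < al -> a < b -> absolutely_continuous a b f ->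
  (forall x, a < x < b -> derivable f x 1) ->
  lebesgue_measure.-integrable `]a, b[%classic (EFin \o derive1 f) ->
  \int[lebesgue_measure]_(y in `[a, b]%classic)
    (powR_gap al a b y * derive1 f y) =
  (b - a) `^ al * (f a + f b) - al *
    (\int[lebesgue_measure]_(y in `[a, b]%classic)
       (f y * (y - a) `^ (al - 1)) +
     \int[lebesgue_measure]_(y in `[a, b]%classic)
       (f y * (b - y) `^ (al - 1))).
Proof.
move=> al0 ab acf df if'.
have mab : measurable (`]a, b[%classic : set (measurableTypeR R)) by [].
pose w := powR_gap al a b.
have w'E x : a < x < b ->
    derive1 w x = al * ((x - a) `^ (al - 1) + (b - x) `^ (al - 1)).
  by move=> /(is_derive_powR_gap al) /(@derive_val _ _ _ _ _ _ _);
     rewrite derive1E.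
have il := integrable_powR_left al0 ab.
have ir := integrable_powR_right al0 ab.
have iw : lebesgue_measure.-integrable `]a, b[%classic (EFin \o derive1 w).
  have := integrableZl mab al (integrableD mab il ir).
  apply: eq_integrable => // x; rewrite inE/= in_itv/= => /w'E ->.
  by rewrite EFinM EFinD.
rewrite (absolutely_continuous_by_parts ab
  (absolutely_continuous_powR_gap al0 ab) acf)//; last first.
  by move=> x /(is_derive_powR_gap al)[].
have ifl := integrable_absolutely_continuousM (ltW ab) acf il.
have ifr := integrable_absolutely_continuousM (ltW ab) acf ir.
have ifw := integrable_absolutely_continuousM (ltW ab) acf iw.
have mE (h : R -> R) : lebesgue_measure.-integrable `]a, b[%classic (EFin \o h)
    -> measurable_fun `]a, b[%classic h.
  by move=> /integrableP[/measurable_EFinP].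
rewrite -!Rintegral_itvoo_cc; [|exact: mE..].
rewrite -RintegralD// -RintegralZl//; last first.
  have := integrableD mab ifl ifr.
  by apply: eq_integrable => // x _ /=; rewrite EFinD.
congr (_ - _).
  rewrite /w /powR_gap !subrr powR0; last by rewrite gt_eqF.
  by ring.
apply: eq_Rintegral => x; rewrite inE/= in_itv/= => /w'E ->.
by ring.
Qed.

(** * Positivity of the Gamma function *)

(** The Gamma function is defined here by a real-valued integral, which
    vanishes by convention when it diverges; so positivity includes
    convergence. On ]0, 1[ the integrand is at most x^(al - 1), and beyond 1
    it is at most the density of the exponential law. *)
Lemma Gamma_gt0 {R : realType} (al : R) : 0 < al -> al <= 1 -> 0 < Gamma al.
Proof.
move=> al0 al1; pose k (x : R) := x `^ (al - 1) * expR (- x).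
have k0 x : 0 <= k x by rewrite mulr_ge0 ?powR_ge0 ?expR_ge0.
have mk : measurable_fun [set: measurableTypeR R] k.
  apply: measurable_funM; first exact: measurable_powR.
  by apply: measurableT_comp.
pose p : R -> R := (fun x : R => x `^ (al - 1)) \_ `]0, 1[.
have ip : lebesgue_measure.-integrable [set: R] (EFin \o p).
  rewrite /p -restrict_EFin; apply/integrable_restrict => //; rewrite setTI.
  exact: integrable_powR.
have ie := integrable_exponential_pdf (@ltr01 R).
have ik : lebesgue_measure.-integrable `]0, +oo[%classic (EFin \o k).
  have mpos : measurable (`]0, +oo[%classic : set (measurableTypeR R)) by [].
  have mT : measurable ([set: R] : set (measurableTypeR R)) by [].
  apply: (le_integrable mpos _ _
    (integrableS mT mpos (@subsetT _ _) (integrableD mT ip ie))).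
    by apply/measurable_EFinP; exact: measurable_funTS mk.
  move=> x /=; rewrite in_itv/= andbT => x0.
  have p0 : 0 <= p x by rewrite /p patchE; case: ifPn => // _; exact: powR_ge0.
  have e0 : 0 <= exponential_pdf 1 x by exact: exponential_pdf_ge0.
  rewrite lee_fin !ger0_norm// ?addr_ge0//.
  have [x1|x1] := ltP x 1.
    apply: (@le_trans _ _ (p x)); last by rewrite lerDl.
    rewrite /p patchE mem_set/= ?in_itv/= ?x0//.
    by rewrite /k ger_pMr ?powR_gt0// -expR0 ler_expR oppr_le0 ltW.
  apply: (@le_trans _ _ (exponential_pdf 1 x)); last by rewrite lerDr.
  rewrite exponential_pdfE; last exact: ltW.
  rewrite mul1r mulN1r /k ler_piMl ?expR_ge0//.
  by rewrite -[leRHS](powRr0 x) ler_powR// subr_le0.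
(* on ]0, 1] one has x^(al - 1) >= 1 and exp(-x) >= 1 / e *)
rewrite -lte_fin /Gamma /Rintegral fineK; last exact: integrable_fin_num ik.
apply: (@lt_le_trans _ _
    (\int[lebesgue_measure]_(x in `]0%R, 1%R]%classic) (k x)%:E)%E); last first.
  apply: ge0_subset_integral => //.
  - by apply/measurable_EFinP; exact: measurable_funTS mk.
  - by move=> x _; rewrite lee_fin.
  - by apply: subset_itvl; rewrite bnd_simp.
apply: (@lt_le_trans _ _
    (\int[lebesgue_measure]_(x in `]0%R, 1%R]%classic) (expR (- 1))%:E)%E).
  rewrite integral_cst//= lebesgue_measure_itv/= lte_fin ltr01 oppr0 adde0.
  by rewrite mule1 lte_fin expR_gt0.
apply: ge0_le_integral => //.
- by apply/measurable_EFinP; exact: measurable_funTS mk.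
- move=> x /=; rewrite in_itv/= => /andP[x0 x1].
  rewrite lee_fin /k -[leLHS]mul1r ler_pM ?expR_ge0//; last first.
    by rewrite ler_expR lerN2.
  by rewrite -[leLHS](powRr0 x) ger_powR ?x0// subr_le0.
Qed.

(** * The identity *)

(** On a bounded interval square integrability implies integrability, since
    |x| <= 1 + |x|^2. *)
Lemma H1_integrable_derive {R : realType} (a b : R) (f : R -> R) :
  H1 a b f ->
  lebesgue_measure.-integrable `]a, b[%classic (EFin \o derive1 f).
Proof.
move=> [_ L2]; set g := (X in X \in _) in L2.
have mab : measurable (`]a, b[%classic : set (measurableTypeR R)) by [].
have mT : measurable ([set: R] : set (measurableTypeR R)) by [].
have mg : measurable_fun [set: measurableTypeR R] g.
  by move: L2; rewrite inE => /andP[/[!inE]].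
have ig2 : lebesgue_measure.-integrable `]a, b[%classic
    (fun x => (`|g x| `^ 2)%:E).
  apply: (integrableS mT mab) => //.
  by have := Lfun_integrable (ler1n R 2) L2.
have i1 : lebesgue_measure.-integrable `]a, b[%classic
    (EFin \o (fun=> 1 : R)).
  apply/integrableP; split; first exact/measurable_EFinP.
  rewrite integral_cst//= lebesgue_measure_itv/=.
  by case: ifPn => _; rewrite ?normr1 ?mul1e ?mule0 -?EFinB ltry.
apply: (le_integrable mab _ _ (integrableD mab i1 ig2)).
  apply/measurable_EFinP.
  apply: (@eq_measurable_fun _ _ _ _ _ g).
    by move=> x xab; rewrite /g patchE xab.
  exact: measurable_funTS mg.
move=> x xab; rewrite /= lee_fin.
rewrite [leRHS]ger0_norm ?addr_ge0 ?powR_ge0//.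
rewrite /g patchE mem_set// powR_mulrn//.
have := sqr_ge0 (`|derive1 f x| - 1); rewrite expr2; nra.
Qed.

(** The weight is homogeneous: a substitution which maps [0, 1] onto [a, b]
    turns it into (b - a)^al times a weight w on [0, 1]. The two orientations
    of the substitution, treated below, change the sign of w. *)
Lemma Rintegral_powR_gap_affine {R : realType} (al a b c s : R)
    (k w : R -> R) :
  0 < al -> a < b -> s != 0 ->
  (fun t => c + s * t) @^-1` `[a, b]%classic = `[0, 1]%classic ->
  (forall t, 0 <= t <= 1 ->
    powR_gap al a b (c + s * t) = (b - a) `^ al * w t) ->
  lebesgue_measure.-integrable `]a, b[%classic (EFin \o k) ->
  \int[lebesgue_measure]_(t in `[0, 1]%classic) (w t * k (c + s * t)) =
  `|s|^-1 * (((b - a) `^ al)^-1 *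
    \int[lebesgue_measure]_(y in `[a, b]%classic) (powR_gap al a b y * k y)).
Proof.
move=> al0 ab s0 pre01 gapE ik.
have mcc : measurable (`[a, b]%classic : set (measurableTypeR R)) by [].
have iw := integrable_itvoo_cc (integrable_absolutely_continuousM (ltW ab)
  (absolutely_continuous_powR_gap al0 ab) ik).
rewrite -RintegralZl// -(Rintegral_affine c s0 mcc); last first.
  have := integrableZl mcc ((b - a) `^ al)^-1 iw.
  by apply: eq_integrable => // x _ /=; rewrite EFinM.
rewrite pre01; apply: eq_Rintegral => t; rewrite inE/= in_itv/= => /gapE ->.
rewrite !mulrA mulVf ?mul1r// gt_eqF// powR_gt0 ?subr_gt0//.
Qed.

Lemma powR_dilation {R : realType} (al d x y t : R) :
  0 <= d -> 0 <= t <= 1 -> x = d * t -> y = d * (1 - t) ->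
  x `^ al = d `^ al * t `^ al /\ y `^ al = d `^ al * (1 - t) `^ al.
Proof.
by move=> d0 /andP[t0 t1] -> ->; rewrite !powRM// subr_ge0.
Qed.

Lemma Rintegral_powR_gap_increasing {R : realType} (al a b : R) (k : R -> R) :
  0 < al -> a < b ->
  lebesgue_measure.-integrable `]a, b[%classic (EFin \o k) ->
  \int[lebesgue_measure]_(t in `[0, 1]%classic)
    ((t `^ al - (1 - t) `^ al) * k (a + (b - a) * t)) =
  (b - a)^-1 * (((b - a) `^ al)^-1 *
    \int[lebesgue_measure]_(y in `[a, b]%classic) (powR_gap al a b y * k y)).
Proof.
move=> al0 ab ik; have ba0 : 0 < b - a by rewrite subr_gt0.
have ba_neq0 : b - a != 0 by rewrite gt_eqF.
rewrite -[X in X^-1 * _](gtr0_norm ba0).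
apply: (Rintegral_powR_gap_affine al0 ab ba_neq0 _ _ ik).
  apply/seteqP; split => t/=; rewrite !in_itv/= => /andP[t0 t1].
    by apply/andP; split; rewrite -(ler_pM2l ba0); lra.
  have ht0 : 0 <= (b - a) * t by rewrite pmulr_rge0.
  have ht1 : (b - a) * t <= b - a by rewrite ger_pMr.
  by apply/andP; split; lra.
move=> t t01; rewrite /powR_gap mulrBr.
have xE : a + (b - a) * t - a = (b - a) * t by ring.
have yE : b - (a + (b - a) * t) = (b - a) * (1 - t) by ring.
by have [-> ->] := powR_dilation al (ltW ba0) t01 xE yE.
Qed.

Lemma Rintegral_powR_gap_decreasing {R : realType} (al a b : R) (k : R -> R) :
  0 < al -> a < b ->
  lebesgue_measure.-integrable `]a, b[%classic (EFin \o k) ->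
  \int[lebesgue_measure]_(t in `[0, 1]%classic)
    (((1 - t) `^ al - t `^ al) * k (b + - (b - a) * t)) =
  (b - a)^-1 * (((b - a) `^ al)^-1 *
    \int[lebesgue_measure]_(y in `[a, b]%classic) (powR_gap al a b y * k y)).
Proof.
move=> al0 ab ik; have ba0 : 0 < b - a by rewrite subr_gt0.
have ba_neq0 : - (b - a) != 0 by rewrite oppr_eq0 gt_eqF.
rewrite -[X in X^-1 * _](gtr0_norm ba0) -normrN.
apply: (Rintegral_powR_gap_affine al0 ab ba_neq0 _ _ ik).
  apply/seteqP; split => t/=; rewrite !in_itv/= => /andP[t0 t1].
    by apply/andP; split; rewrite -(ler_pM2l ba0); lra.
  have ht0 : 0 <= (b - a) * t by rewrite pmulr_rge0.
  have ht1 : (b - a) * t <= b - a by rewrite ger_pMr.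
  by apply/andP; split; lra.
move=> t t01; rewrite /powR_gap mulrBr.
have xE : b - (b + - (b - a) * t) = (b - a) * t by ring.
have yE : b + - (b - a) * t - a = (b - a) * (1 - t) by ring.
by have [-> ->] := powR_dilation al (ltW ba0) t01 xE yE.
Qed.

Theorem lemma2p1 (R : realType) (theta1 theta2 alpha : R) (B f : R -> R)
    (htheta : theta1 < theta2) (halpha0 : 0 < alpha) (halpha1 : alpha <= 1)
    (hB : 0 < B alpha)
    (hdf : forall x : R, theta1 < x < theta2 -> derivable f x 1)
    (hf : H1 theta1 theta2 f) :
  (2 * (theta2 - theta1) `^ alpha +
     (1 - alpha) * 2 `^ (alpha + 1) * Gamma alpha)
    / (theta2 - theta1) `^ (alpha + 1)
    * (f theta1 + f theta2 + 2 * f ((theta1 + theta2) / 2))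
  - 2 `^ (alpha + 1) * B alpha * Gamma alpha
    / (theta2 - theta1) `^ (alpha + 1)
    * (ABIr B alpha ((theta1 + theta2) / 2) f theta1
       + ABIl B alpha theta1 f ((theta1 + theta2) / 2)
       + ABIl B alpha ((theta1 + theta2) / 2) f theta2
       + ABIr B alpha theta2 f ((theta1 + theta2) / 2))
  = \int[lebesgue_measure]_(t in `[0, 1]%classic)
      (((1 - t) `^ alpha - t `^ alpha)
       * derive1 f ((1 + t) / 2 * theta1 + (1 - t) / 2 * theta2))
  + \int[lebesgue_measure]_(t in `[0, 1]%classic)
      ((t `^ alpha - (1 - t) `^ alpha)
       * derive1 f ((1 + t) / 2 * theta2 + (1 - t) / 2 * theta1)).
Proof.
have [acf _] := hf.
have if' := H1_integrable_derive hf.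
have [h hE] : exists h, h = (theta2 - theta1) / 2.
  by exists ((theta2 - theta1) / 2).
have [m mE] : exists m, m = (theta1 + theta2) / 2.
  by exists ((theta1 + theta2) / 2).
rewrite -mE.
have h0 : 0 < h by rewrite hE divr_gt0// subr_gt0.
have tm : theta1 < m by rewrite mE; lra.
have mt : m < theta2 by rewrite mE; lra.
have mh1 : m - theta1 = h by rewrite mE hE; field.
have mh2 : theta2 - m = h by rewrite mE hE; field.
have if1 : lebesgue_measure.-integrable `]theta1, m[%classic
    (EFin \o derive1 f).
  by apply: integrableS if' => //; apply: subset_itvl; rewrite bnd_simp ltW.
have if2 : lebesgue_measure.-integrable `]m, theta2[%classic
    (EFin \o derive1 f).
  by apply: integrableS if' => //; apply: subset_itvr; rewrite bnd_simp ltW.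
have Hl := Rintegral_powR_gap_decreasing halpha0 tm if1.
have Hr := Rintegral_powR_gap_increasing halpha0 mt if2.
rewrite (powR_gap_by_parts halpha0 tm) ?mh1 in Hl; last 3 first.
- exact: (absolutely_continuousS (lexx _) (ltW mt) acf).
- by move=> x /andP[x1 x2]; apply: hdf; rewrite x1 (lt_trans x2).
- exact: if1.
rewrite (powR_gap_by_parts halpha0 mt) ?mh2 in Hr; last 3 first.
- exact: (absolutely_continuousS (ltW tm) (lexx _) acf).
- by move=> x /andP[x1 x2]; apply: hdf; rewrite x2 andbT (lt_trans _ x1).
- exact: if2.
under [X in _ = X + _]eq_Rintegral => t _.
  rewrite (_ : (1 + t) / 2 * theta1 + _ = m + - h * t); last first.
    by rewrite mE hE; field.
  over.
under [X in _ = _ + X]eq_Rintegral => t _.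
  rewrite (_ : (1 + t) / 2 * theta2 + _ = m + h * t); last first.
    by rewrite mE hE; field.
  over.
rewrite Hl Hr {Hl Hr}.
have G0 : Gamma alpha != 0 by rewrite gt_eqF// Gamma_gt0.
have B0 : B alpha != 0 by rewrite gt_eqF.
have hn0 : h != 0 by rewrite gt_eqF.
have L2h : theta2 - theta1 = 2 * h by rewrite hE; field.
rewrite /ABIl /ABIr L2h.
set I1 := (\int[lebesgue_measure]_(y in `[theta1, m]%classic)
  (f y * (y - theta1) `^ (alpha - 1))).
set I2 := (\int[lebesgue_measure]_(y in `[theta1, m]%classic)
  (f y * (m - y) `^ (alpha - 1))).
set I3 := (\int[lebesgue_measure]_(y in `[m, theta2]%classic)
  (f y * (y - m) `^ (alpha - 1))).
set I4 := (\int[lebesgue_measure]_(y in `[m, theta2]%classic)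
  (f y * (theta2 - y) `^ (alpha - 1))).
have pS x : 0 < x -> x `^ (alpha + 1) = x `^ alpha * x.
  move=> x0; rewrite powRD; first by rewrite powRr1// ltW.
  by rewrite (gt_eqF x0) implybT.
rewrite !pS ?mulr_gt0// powRM ?ltW//.
have P0 : h `^ alpha != 0 by rewrite gt_eqF// powR_gt0.
have Q0 : (2 : R) `^ alpha != 0 by rewrite gt_eqF// powR_gt0.
field.
by rewrite P0 hn0 G0 B0 Q0.
Qed.
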